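(* For all $\varepsilon>0$, there is $d_0\in\mathbb{N}$ such that the following holds. Let $G$ be a graph with degeneracy $d\geq d_0$ and let $k$ be a real number with $k\geq(1+\varepsilon)d/\ln d$. Then $p^\ast(G,k)\geq 1-\varepsilon$.
   Context: All graphs are finite and simple. $\mathbb{N}=\{0,1,2,\ldots\}$ and $[k]=\{1,\ldots,k\}$. A graph $G$ is $d$-degenerate if there is an ordering of $V(G)$ in which each vertex has at most $d$ neighbors among the preceding vertices; the degeneracy of $G$ is the smallest $d\in\mathbb{N}$ such that $G$ is $d$-degenerate. A (DP-)cover of $G$ is a pair $\mathcal{H}=(L,H)$ where $H$ is a graph and $L:V(G)\to 2^{V(H)}$ is such that: $\{L(v):v\in V(G)\}$ is a partition of $V(H)$ into $|V(G)|$ independent sets; for each edge $uv\in E(G)$ the edges of $H$ between $L(u)$ and $L(v)$ form a matching; and $H$ has no other edges than those between $L(u)$ and $L(v)$ with $uv\in E(G)$. For $b\in\mathbb{N}$, a $b$-fold transversal of $\mathcal{H}$ is a set $T\subseteq V(H)$ with $|L(v)\cap T|=b$ for every $v\in V(G)$; it is independent if it is an independent set in $H$. $G$ is $(\mathcal{H},b)$-colorable if $\mathcal{H}$ has an independent $b$-fold transversal. For $a\in\mathbb{N}$, the random $a$-fold cover $\mathcal{H}(G,a)=(L,H)$ is defined by $L(v)=\{(v,i):i\in[a]\}$ for $v\in V(G)$ and, independently for each edge $uv\in E(G)$, the edges of $H$ between $L(u)$ and $L(v)$ form a perfect matching chosen uniformly at random among the $a!$ perfect matchings between $L(u)$ and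 $L(v)$ ($H$ has no other edges). $G$ is $(a,b)$-DP-colorable with probability $p$ if $\mathbb{P}(G\text{ is }(\mathcal{H}(G,a),b)\text{-colorable})=p$. For real $k\geq 1$, $$p^\ast(G,k)=\sup\{p:\ \exists\, a,b\in\mathbb{N}\text{ such that } a/b\leq k\text{ and }G\text{ is }(a,b)\text{-DP-colorable with probability }p\},$$ where $b\geq 1$ so that $a/b$ makes sense. *)

(* Defs.v *)
From HB Require Import structures.
From mathcomp Require Import all_boot all_order all_algebra.
From mathcomp Require Import classical_sets reals exp.

Set Implicit Arguments.
Unset Strict Implicit.
Unset Printing Implicit Defensive.

Import Order.TTheory GRing.Theory Num.Theory.

Record sgraph := SGraph {
  vertex :> finType;
  adj : rel vertex;
  adj_sym : symmetric adj;
  adj_irr : irreflexive adj }.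

Definition edges (G : sgraph) : {set {set G}} :=
  [set E : {set G} | [exists u, exists v, adj u v && (E == [set u; v])]].

Definition edge (G : sgraph) : finType := {E : {set G} | E \in edges G}.

Definition independent (G : sgraph) (S : {set G}) : bool :=
  [forall x in S, forall y in S, ~~ adj x y].

(* A duplicate-free tuple of length #|G| is an ordering of the vertices. *)
Definition degenerate (G : sgraph) (d : nat) : bool :=
  [exists s : #|G|.-tuple G,
    uniq s &&
    [forall v, #|[set u | adj u v & index u s < index v s]| <= d]].

Lemma degenerate_ex (G : sgraph) : exists d, degenerate G d.
Proof.
exists #|G|; apply/existsP; exists (enum_tuple G).
by rewrite enum_uniq; apply/forallP => v; apply: max_card.
Qed.

Definition degeneracy (G : sgraph) : nat := ex_minn (degenerate_ex G).

(* [cover_lists] and [cover_disjoint] say that (L v)_v is a partition of V(H)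
   indexed by V(G); parts may be empty, as in a 0-fold cover. In
   [cover_matching], exchanging u and v gives the other half of the matching
   condition. *)
Record cover (G : sgraph) := Cover {
  cover_graph : sgraph;
  cover_list : G -> {set cover_graph};
  cover_lists : forall x, exists v, x \in cover_list v;
  cover_disjoint : forall u v, u != v ->
    [disjoint cover_list u & cover_list v];
  cover_independent : forall v, independent (cover_list v);
  cover_matching : forall u v x y y', adj u v ->
    x \in cover_list u -> y \in cover_list v -> y' \in cover_list v ->
    adj x y -> adj x y' -> y = y';
  cover_adj : forall u v x y,
    x \in cover_list u -> y \in cover_list v -> adj x y -> adj u v }.

Definition transversal_fold (G : sgraph) (C : cover G) (b : nat)
    (S : {set cover_graph C}) : bool :=
  [forall v, #|cover_list C v :&: S| == b].

Definition cover_colorable (G : sgraph) (C : cover G) (b : nat) : bool :=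
  [exists S : {set cover_graph C}, transversal_fold b S && independent S].

Section RandomCover.
Variables (G : sgraph) (a : nat).

Definition layer (v : G) : {set G * 'I_a} := [set x | x.1 == v].

(* For E = {u, v}: every member of M is a pair {x, y} with one end in the layer
   of u and the other in the layer of v, and each vertex of these two layers
   lies in exactly one member of M. *)
Definition perfect_matching (E : {set G}) (M : {set {set G * 'I_a}}) : bool :=
  [forall m in M,
     exists x, exists y, (m == [set x; y]) && ([set x.1; y.1] == E)] &&
  [forall v in E, forall x in layer v, #|[set m in M | x \in m]| == 1].

Definition matching (E : edge G) : finType :=
  {M : {set {set G * 'I_a}} | perfect_matching (val E) M}.

(* The sample space: one perfect matching for each edge of G. *)
Definition outcome : finType := {dffun forall E : edge G, matching E}.

Definition outcome_adj (w : outcome) : rel (G * 'I_a)%type :=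
  fun x y => [exists E : edge G, [set x; y] \in val (w E)].

Lemma matching_proj (E : edge G) (M : matching E) (x y : G * 'I_a) :
  [set x; y] \in val M -> [set x.1; y.1] = val E.
Proof.
move=> xyM; have /andP[/forall_inP/(_ _ xyM) + _] := valP M.
case/existsP => x1 /existsP[y1 /andP[/eqP e /eqP Ee]].
by rewrite -[RHS]Ee -!(imset_set1 fst) -!imsetU e.
Qed.

Lemma edge_adj (u v : G) : ([set u; v] \in edges G) = adj u v.
Proof.
rewrite inE; apply/existsP/idP => [[u' /existsP[v' /andP[uv /eqP e]]]|uv]; last first.
  by exists u; apply/existsP; exists v; rewrite uv eqxx.
have u'v' : u' != v' by apply: contraTneq uv => ->; rewrite adj_irr.
have := set21 u v; have := set22 u v; rewrite e !in_set2.
have := set21 u' v'; have := set22 u' v'; rewrite -e !in_set2.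
case/orP => /eqP ? /orP[] /eqP ? _ _; subst => //; rewrite ?eqxx // in u'v' *.
by rewrite adj_sym.
Qed.

Lemma outcome_adj_adj (w : outcome) x y : outcome_adj w x y -> adj x.1 y.1.
Proof.
by case/existsP => E /matching_proj e; rewrite -edge_adj e; exact: (valP E).
Qed.

Lemma outcome_adj_sym (w : outcome) : symmetric (outcome_adj w).
Proof. by move=> x y; apply: eq_existsb => E; rewrite finset.setUC. Qed.

Lemma outcome_adj_irr (w : outcome) : irreflexive (outcome_adj w).
Proof.
by move=> x; apply/negbTE/negP => /outcome_adj_adj; rewrite adj_irr.
Qed.

Definition outcome_graph (w : outcome) : sgraph :=
  SGraph (outcome_adj_sym w) (outcome_adj_irr w).

Lemma layer_lists (x : G * 'I_a) : exists v, x \in layer v.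
Proof. by exists x.1; rewrite inE. Qed.

Lemma layer_disjoint (u v : G) : u != v -> [disjoint layer u & layer v].
Proof.
move=> uv; apply/pred0P => x /=; rewrite !inE.
by apply/negP => /andP[/eqP xu /eqP xv]; rewrite -xu -xv eqxx in uv.
Qed.

Lemma layer_independent (w : outcome) (v : G) :
  @independent (outcome_graph w) (layer v).
Proof.
apply/forall_inP => x; rewrite inE => /eqP xv.
apply/forall_inP => y; rewrite inE => /eqP yv.
by apply/negP => /outcome_adj_adj; rewrite xv yv adj_irr.
Qed.

Lemma layer_matching (w : outcome) (u v : G) (x y y' : G * 'I_a) :
  adj u v -> x \in layer u -> y \in layer v -> y' \in layer v ->
  outcome_adj w x y -> outcome_adj w x y' -> y = y'.
Proof.
rewrite !inE => uv /eqP xu /eqP yv /eqP y'v /existsP[E xyE] /existsP[E' xyE'].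
have eE := matching_proj xyE; have eE' := matching_proj xyE'.
have ? : E = E' by apply: val_inj; rewrite -eE -eE' yv y'v.
subst E'; have uE : u \in val E by rewrite -eE xu finset.set21.
have xu' : x \in layer u by rewrite inE xu.
have /andP[_ /forall_inP/(_ u uE)/forall_inP/(_ x xu')] := valP (w E).
move=> /cards1P[m em].
have : [set x; y] \in [set m] by rewrite -em inE xyE set21.
have : [set x; y'] \in [set m] by rewrite -em inE xyE' set21.
rewrite !inE => /eqP <- /eqP e.
have := set22 x y; rewrite e !inE => /orP[/eqP yx|/eqP //].
by move: uv; rewrite -xu -yv yx adj_irr.
Qed.

Lemma layer_adj (w : outcome) (u v : G) (x y : G * 'I_a) :
  x \in layer u -> y \in layer v -> outcome_adj w x y -> adj u v.
Proof. by rewrite !inE => /eqP <- /eqP <- /outcome_adj_adj. Qed.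

Definition random_cover (w : outcome) : cover G :=
  @Cover G (outcome_graph w) layer layer_lists layer_disjoint
    (layer_independent w) (@layer_matching w) (@layer_adj w).

End RandomCover.

Local Open Scope ring_scope.

(* Independent, uniformly chosen matchings: the mass of an outcome is the
   product over the edges of the uniform masses. *)
Definition outcome_mass (R : realType) (G : sgraph) (a : nat)
    (w : outcome G a) : R :=
  \prod_(E : edge G) (#|matching a E|%:R)^-1.

Definition outcome_prob (R : realType) (G : sgraph) (a : nat)
    (P : pred (outcome G a)) : R :=
  \sum_(w : outcome G a | P w) outcome_mass R w.

Definition DP_colorable_with_prob (R : realType) (G : sgraph) (a b : nat)
    (p : R) : Prop :=
  outcome_prob R (fun w : outcome G a => cover_colorable (random_cover w) b)
    = p.

Definition pstar (R : realType) (G : sgraph) (k : R) : R :=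
  sup [set p : R | exists a b : nat,
    [/\ (0 < b)%N, a%:R / b%:R <= k & DP_colorable_with_prob G a b p]]%classic.

(* Main.v *)
Require Import Defs.
From mathcomp Require Import all_boot all_order all_algebra all_fingroup.
From mathcomp Require Import classical_sets reals sequences exp.
From mathcomp Require Import fintype finset.
From mathcomp Require Import ring lra zify.

Import Order.TTheory GRing.Theory Num.Theory.
Local Open Scope ring_scope.

(** Why the theorem is true.  Put x = b / a.  Colour the vertices greedily, in
    an order in which every vertex has at most d earlier neighbours, giving each
    vertex b of the a colours of its list.  When v is reached, each earlier
    neighbour u blocks exactly b colours of v, namely the partners of the b
    colours chosen at u, and as the matching between the lists of u and v has
    played no part so far, this b-set is uniform, independently for the various
    u.  Hence about a (1 - x)^d colours of v, or more, remain free, and the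
    greedy step succeeds as soon as this is comfortably larger than b, that is
    when (1 - x)^d > x.  For 1 / x close to (1 + eps) d / ln d the left side is
    d^(-1 / (1 + eps) + o(1)), which exceeds ln d / d, hence x, for large d.  It is enough to take x = 1 / a0 with a0 the
    integer part of (1 + eps) d / ln d ([list_size_exists]).

    The failure probability at one vertex tends to 0 when a and b grow with the
    ratio a / b = a0 fixed.  The supremum in [pstar] allows a and b to depend on
    the whole graph, so Chebyshev's inequality and a union bound over the
    vertices suffice ([colorable_prob]).

    Conditioning on the colours chosen before v is replaced by a symmetry.  For
    a family p of permutations of the a colours, one for each vertex u, permute
    by p u the ends in the list of v of the matching between u and v.  This is
    a bijection of the sample space ([relabel_outcome_inj]) that leaves the
    colours of the vertices before v unchanged ([colour_relabel]).  So the
    number of outcomes that fail at v can be averaged over p, and for a fixed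
    outcome only the elementary question remains of how many colours avoid the
    images of fixed b-sets under independent uniform permutations
    ([unblocked_chebyshev]). *)

Set Implicit Arguments.
Unset Strict Implicit.
Unset Printing Implicit Defensive.

(** * Permutations avoiding a set at one or two points *)

Section PermCount.
Variables (R : realFieldType) (a : nat) (B : {set 'I_a}).

Definition avoid1 (i : 'I_a) := [set s : 'S_a | i \notin [set s j | j in B]].
Definition avoid2 (i j : 'I_a) := avoid1 i :&: avoid1 j.

Lemma card_compl_image (s : 'S_a) : #|[set i | s \in avoid1 i]| = (a - #|B|)%N.
Proof.
have -> : [set i | s \in avoid1 i] = ~: [set s j | j in B].
  by apply/setP => i; rewrite !inE.
by rewrite cardsCs finset.setCK card_ord card_imset //; apply: perm_inj.
Qed.

(** Composing with a transposition moves the avoided point, so the numbers of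
    permutations below do not depend on the points; they are then found by
    summing over the points, each permutation avoiding [a - #|B|] of them. *)
Lemma avoid1_tperm (i j k : 'I_a) (s : 'S_a) :
  (s * tperm i j \in avoid1 k)%g = (s \in avoid1 (tperm i j k)).
Proof.
rewrite !inE -{1}(tpermK i j k); congr (~~ _).
have -> : [set (s * tperm i j)%g x | x in B] = tperm i j @: [set s x | x in B].
  by rewrite -imset_comp; apply: eq_imset => x; rewrite permM.
by rewrite mem_imset //; apply: perm_inj.
Qed.

Lemma card_avoid1_const (i j : 'I_a) : #|avoid1 i| = #|avoid1 j|.
Proof.
rewrite -(card_preimset (avoid1 i) (mulIg (tperm i j))).
by apply: eq_card => s; rewrite inE avoid1_tperm tpermL.
Qed.

Lemma card_avoid2_const (i j k : 'I_a) : j != i -> k != i ->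
  #|avoid2 i j| = #|avoid2 i k|.
Proof.
move=> ji ki; rewrite -(card_preimset (avoid2 i j) (mulIg (tperm j k))).
apply: eq_card => s; rewrite inE !in_setI !avoid1_tperm tpermL tpermD //.
Qed.

Lemma card_avoid1 (i : 'I_a) : (#|avoid1 i| * a = #|{: 'S_a}| * (a - #|B|))%N.
Proof.
transitivity (\sum_(j < a) #|avoid1 j|)%N.
  rewrite (eq_bigr (fun=> #|avoid1 i|)) => [|j _]; last exact: card_avoid1_const.
  by rewrite sum_nat_const card_ord mulnC.
transitivity (\sum_(s : 'S_a) #|[set i | s \in avoid1 i]|)%N; last first.
  rewrite (eq_bigr (fun=> (a - #|B|)%N)) => [|s _]; last exact: card_compl_image.
  by rewrite sum_nat_const.
rewrite (eq_bigr (fun j => \sum_(s : 'S_a) (s \in avoid1 j))%N); last first.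
  by move=> j _; rewrite -sum1_card big_mkcond.
rewrite exchange_big; apply: eq_bigr => s _.
by rewrite -sum1_card [RHS]big_mkcond; apply: eq_bigr => j _; rewrite [in RHS]inE.
Qed.

Lemma card_avoid2 (i j : 'I_a) : i != j ->
  (#|avoid2 i j| * a.-1 = #|avoid1 i| * (a - #|B|).-1)%N.
Proof.
move=> ij.
transitivity (\sum_(k < a | k != i) #|avoid2 i k|)%N.
  rewrite (eq_bigr (fun=> #|avoid2 i j|)) => [|k ki]; last first.
    by apply: card_avoid2_const; rewrite // eq_sym.
  rewrite sum_nat_const mulnC; congr (_ * _)%N.
  by rewrite cardC1 card_ord.
rewrite (eq_bigr (fun k => \sum_(s in avoid1 i) (s \in avoid1 k))%N); last first.
  move=> k _; rewrite -sum1_card -big_mkcondr.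
  by apply: eq_bigl => s; rewrite in_setI.
rewrite exchange_big -sum_nat_const; apply: eq_bigr => s si.
rewrite -(card_compl_image s) (cardsD1 i) [i \in _]inE si -sum1_card.
rewrite -big_mkcondr; apply: eq_bigl => k.
by rewrite !in_setD1 [in RHS]inE.
Qed.

Definition keep : R := (a - #|B|)%N%:R / a%:R.

Lemma avoid1E (i : 'I_a) : #|avoid1 i|%:R = #|{: 'S_a}|%:R * keep.
Proof.
have a0 : a%:R != 0 :> R by rewrite pnatr_eq0; case: (a) i => [[]|].
by apply: (mulIf a0); rewrite -natrM card_avoid1 natrM /keep mulrA divfK.
Qed.

(** Avoiding two points is negatively correlated: the ratio
    [(a - #|B|).-1 / a.-1] gained at the second point is at most [keep]. *)
Lemma avoid2_le (i j : 'I_a) : i != j ->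
  #|avoid2 i j|%:R <= #|{: 'S_a}|%:R * keep ^+ 2.
Proof.
move=> ij; have a1 : (1 < a)%N.
  have := ltn_ord i; have := ltn_ord j; move/eqP: ij => ij.
  have : val i <> val j by move=> /val_inj.
  by move=> /=; lia.
have a1R : 0 < a.-1%:R :> R by rewrite ltr0n; lia.
have aR : 0 < a%:R :> R by rewrite ltr0n; lia.
rewrite -(ler_pM2r a1R) -natrM card_avoid2 // natrM avoid1E expr2 -!mulrA.
rewrite ler_wpM2l // ler_wpM2l //.
rewrite ler_wpM2l ?invr_ge0 // mulrA mulrAC ler_pdivlMr // -!natrM ler_nat.
by have := max_card (mem B); rewrite card_ord; nia.
Qed.

End PermCount.

(** * Concentration of the number of unblocked colours *)

Section Chebyshev.
Variables (R : realFieldType) (I : finType) (D : {set I}) (a b : nat).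
Variable B : I -> {set 'I_a}.
Hypothesis cardB : forall u, u \in D -> #|B u| = b.

Let K := {ffun I -> 'S_a}.

Definition unblocked (p : K) : {set 'I_a} :=
  [set i | [forall u in D, p u \in avoid1 (B u) i]].

Let x : R := (a - b)%N%:R / a%:R.
Let q : R := x ^+ #|D|.

Lemma card_perm_neq0 : #|{: 'S_a}|%:R != 0 :> R.
Proof. by rewrite pnatr_eq0 -lt0n; apply/card_gt0P; exists 1%g. Qed.

(** Independence of the coordinates of a uniform family of permutations. *)
Lemma card_independent (F : I -> {set 'S_a}) :
  #|[set p : K | [forall u in D, p u \in F u]]|%:R =
  #|{: K}|%:R * \prod_(u in D) (#|F u|%:R / #|{: 'S_a}|%:R) :> R.
Proof.
pose F' u := if u \in D then F u else [set: 'S_a].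
have -> : #|[set p : K | [forall u in D, p u \in F u]]| = #|family F'|.
  apply: eq_card => p; rewrite inE; apply/forall_inP/familyP => h u.
    by rewrite /F'; case: ifP => [/h|]; rewrite ?inE.
  by move=> uD; have := h u; rewrite /F' uD.
rewrite card_family card_ffun foldrE big_image /=.
rewrite natr_prod [X in _ * X]big_mkcond /= natrX -prodr_const.
rewrite -big_split /=; apply: eq_bigr => u _; rewrite /F'.
case: ifP => _; first by rewrite mulrC divfK ?card_perm_neq0.
by rewrite mulr1 cardsT.
Qed.

Lemma sum_unblocked1 (i : 'I_a) :
  \sum_(p : K) (i \in unblocked p)%:R = #|{: K}|%:R * q.
Proof.
transitivity (#|[set p : K | [forall u in D, p u \in avoid1 (B u) i]]|%:R : R).
  rewrite -sum1_card natr_sum [RHS]big_mkcond; apply: eq_bigr => p _.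
  by rewrite !inE; case: ifP.
rewrite (card_independent (fun u => avoid1 (B u) i)); congr (_ * _).
rewrite /q -prodr_const; apply: eq_bigr => u uD.
by rewrite avoid1E mulrAC divff ?card_perm_neq0 // mul1r /keep cardB.
Qed.

Lemma sum_unblocked2 (i j : 'I_a) : i != j ->
  \sum_(p : K) (i \in unblocked p)%:R * (j \in unblocked p)%:R
    <= #|{: K}|%:R * q ^+ 2.
Proof.
move=> ij.
pose F u := avoid2 (B u) i j.
have -> : \sum_(p : K) (i \in unblocked p)%:R * (j \in unblocked p)%:R
   = #|[set p : K | [forall u in D, p u \in F u]]|%:R :> R.
  rewrite -sum1_card natr_sum [RHS]big_mkcond; apply: eq_bigr => p _.
  rewrite -natrM mulnb.
  have -> : (i \in unblocked p) && (j \in unblocked p) =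
            (p \in [set p : K | [forall u in D, p u \in F u]]).
    rewrite !inE; apply/andP/forall_inP => [[/forall_inP hi /forall_inP hj] u uD|h].
      by rewrite in_setI hi ?hj.
    by split; apply/forall_inP => u /h; rewrite in_setI => /andP[].
  by case: ifP.
rewrite card_independent ler_wpM2l // /q -exprM mulnC exprM -prodr_const.
apply: ler_prod => u uD; rewrite divr_ge0 //=.
rewrite ler_pdivrMr ?lt0r ?card_perm_neq0 //= mulrC.
by have := avoid2_le R (B u) ij; rewrite /keep cardB.
Qed.

(** The mean is exactly [a * q]; by negative correlation the pairs of distinct
    colours contribute at most [(a * q) ^+ 2] to the second moment, so that the
    variance is at most the diagonal contribution [a * q]. *)
Lemma unblocked_variance :
  \sum_(p : K) (#|unblocked p|%:R - a%:R * q) ^+ 2 <= #|{: K}|%:R * a%:R.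
Proof.
have X1 : \sum_(p : K) #|unblocked p|%:R = #|{: K}|%:R * (a%:R * q).
  under eq_bigr do rewrite -sum1_card natr_sum big_mkcond /=.
  rewrite exchange_big /= (eq_bigr (fun=> #|{: K}|%:R * q)) => [|i _]; last first.
    by rewrite -(sum_unblocked1 i); apply: eq_bigr => p _; case: ifP.
  by rewrite sumr_const card_ord -[LHS]mulr_natr; ring.
have X2 : \sum_(p : K) #|unblocked p|%:R ^+ 2
    <= #|{: K}|%:R * (a%:R * q + a%:R ^+ 2 * q ^+ 2).
  (* The square counts pairs of colours; i = j gives the term a * q. *)
  have E (p : K) : #|unblocked p|%:R ^+ 2 =
     \sum_(i < a) \sum_(j < a) (i \in unblocked p)%:R * (j \in unblocked p)%:R :> R.
    have -> : #|unblocked p|%:R = \sum_(i < a) (i \in unblocked p)%:R :> R.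
      rewrite -sum1_card natr_sum big_mkcond.
      by apply: eq_bigr => i _; case: ifP.
    by rewrite expr2 mulr_suml; apply: eq_bigr => i _; rewrite mulr_sumr.
  under eq_bigr do rewrite E.
  rewrite exchange_big /=.
  apply: (@le_trans _ _ (\sum_(i < a) #|{: K}|%:R * (q + a%:R * q ^+ 2))); last first.
    rewrite sumr_const card_ord -[leLHS]mulr_natr le_eqVlt.
    by apply/orP; left; apply/eqP; ring.
  apply: ler_sum => i _; rewrite exchange_big (bigD1 i) //= mulrDr lerD //.
    rewrite -(sum_unblocked1 i); apply: ler_sum => p _.
    by rewrite -natrM mulnb andbb.
  have q2 : 0 <= #|{: K}|%:R * q ^+ 2 by rewrite mulr_ge0 ?sqr_ge0.
  apply: (@le_trans _ _ (\sum_(j < a) #|{: K}|%:R * q ^+ 2)); last first.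
    rewrite sumr_const card_ord -[leLHS]mulr_natr le_eqVlt.
    by apply/orP; left; apply/eqP; ring.
  rewrite [leRHS](bigD1 i) //= ler_wpDl //; apply: ler_sum => j ji.
  by apply: sum_unblocked2; rewrite eq_sym.
have q01 : 0 <= q <= 1.
  rewrite exprn_ge0 ?divr_ge0 //= exprn_ile1 ?divr_ge0 //.
  rewrite /x; case: (posnP a) => [->|a0]; first by rewrite sub0n mul0r.
  by rewrite ler_pdivrMr ?ltr0n // mul1r ler_nat leq_subr.
set N := #|{: K}|%:R in X1 X2 *.
have N0 : 0 <= N by [].
have a0 : 0 <= a%:R :> R by [].
have -> : \sum_(p : K) (#|unblocked p|%:R - a%:R * q) ^+ 2 =
  \sum_(p : K) #|unblocked p|%:R ^+ 2 - (a%:R * q) *+ 2 * \sum_(p : K) #|unblocked p|%:R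
  + N * (a%:R * q) ^+ 2.
  rewrite mulr_sumr -sumrB /N [X in _ + X]mulr_natl -sumr_const -big_split /=.
  by apply: eq_bigr => p _; ring.
rewrite X1.
have : N * (a%:R * q) <= N * a%:R by rewrite ler_wpM2l // ler_piMr //; lra.
move: X2; lra.
Qed.

Lemma unblocked_chebyshev (g : R) : 0 <= g -> b%:R + a%:R * g <= a%:R * q ->
  #|[set p : K | (#|unblocked p| < b)%N]|%:R * (a%:R * g) ^+ 2
    <= #|{: K}|%:R * a%:R.
Proof.
move=> g0 bq; apply: le_trans unblocked_variance.
rewrite -sum1_card natr_sum mulr_suml big_mkcond /=; apply: ler_sum => p _.
rewrite inE; case: ifP => [h|_]; last exact: sqr_ge0.
have : #|unblocked p|%:R <= b%:R :> R by rewrite ler_nat ltnW.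
have : 0 <= a%:R * g by rewrite mulr_ge0.
rewrite mul1r; set A := a%:R * g in bq *; set C := a%:R * q in bq *; set X := _%:R.
move=> A0 Xb; rewrite -[leRHS]sqrrN; apply: lerXn2r; rewrite ?nnegrE; lra.
Qed.

End Chebyshev.

(** * Relabelling the colours of one vertex *)

Section Relabel.
Variables (G : sgraph) (a : nat) (v : G).

Definition relabel (s : 'S_a) (x : G * 'I_a) : G * 'I_a :=
  (x.1, if x.1 == v then s x.2 else x.2).

Lemma relabelK (s : 'S_a) : cancel (relabel s) (relabel s^-1%g).
Proof. by case=> u i; rewrite /relabel /=; case: (u == v); rewrite ?permK. Qed.

Lemma relabelKV (s : 'S_a) : cancel (relabel s^-1%g) (relabel s).
Proof. by case=> u i; rewrite /relabel /=; case: (u == v); rewrite ?permKV. Qed.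

Lemma relabel_inj (s : 'S_a) : injective (relabel s).
Proof. exact: can_inj (relabelK s). Qed.

Definition relabel_matching (s : 'S_a) (M : {set {set G * 'I_a}}) :=
  [set relabel s @: m | m : {set G * 'I_a} in M].

Lemma mem_relabel_matching (s : 'S_a) M (x y : G * 'I_a) :
  ([set x; y] \in relabel_matching s M) =
  ([set relabel s^-1%g x; relabel s^-1%g y] \in M).
Proof.
rewrite -[in LHS](relabelKV s x) -[in LHS](relabelKV s y).
rewrite -!(imset_set1 (relabel s)) -imsetU mem_imset //.
exact/imset_inj/relabel_inj.
Qed.

Lemma relabel_perfect (s : 'S_a) (E : {set G}) M :
  perfect_matching E M -> perfect_matching E (relabel_matching s M).
Proof.
case/andP => /forall_inP MP /forall_inP MV; apply/andP; split.
  apply/forall_inP => _ /imsetP[m mM ->].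
  have /existsP[x /existsP[y /andP[/eqP -> xyE]]] := MP _ mM.
  apply/existsP; exists (relabel s x); apply/existsP; exists (relabel s y).
  by rewrite imsetU !imset_set1 eqxx.
apply/forall_inP => u uE; apply/forall_inP => x xu.
have xu' : relabel s^-1%g x \in layer a u by move: xu; rewrite !inE.
have /forall_inP/(_ _ xu')/eqP <- := MV u uE.
apply/eqP; rewrite -[RHS](card_imset _ (imset_inj (@relabel_inj s))).
apply: eq_card => m.
rewrite inE; apply/andP/imsetP => [[/imsetP[m0 m0M -> xm]]|[m0]].
  exists m0 => //; rewrite inE m0M /=.
  by rewrite -(mem_imset _ _ (@relabel_inj s)) relabelKV.
rewrite inE => /andP[m0M xm0] ->; split; first exact: imset_f.
by rewrite -(relabelKV s x) mem_imset //; apply: relabel_inj.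
Qed.

(** The index of the permutation applied to the edge [E].  Edges that miss [v]
    need no separate case: [relabel] fixes every vertex that they match. *)
Definition other_end (E : {set G}) : G := odflt v [pick u in E :\ v].

Lemma other_endE (u : G) : u != v -> other_end [set u; v] = u.
Proof.
rewrite /other_end => uv; case: pickP => [x|/(_ u)]; rewrite !inE.
  by case/andP => /negbTE -> /orP[/eqP|].
by rewrite uv eqxx.
Qed.

(** All edges at [v] are relabelled, also those to later neighbours: the colours
    of the vertices before [v] depend on none of them, and the uniform
    definition makes injectivity immediate. *)
Definition relabel_outcome (p : {ffun G -> 'S_a}) (w : outcome G a) : outcome G a :=
  [ffun E : edge G => exist _ (relabel_matching (p (other_end (val E))) (val (w E)))
     (relabel_perfect (p (other_end (val E))) (valP (w E)))].

Lemma relabel_outcomeE p w E :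
  val (relabel_outcome p w E) = relabel_matching (p (other_end (val E))) (val (w E)).
Proof. by rewrite ffunE. Qed.

Lemma relabel_outcome_inj p : injective (relabel_outcome p).
Proof.
move=> w w' e; apply/ffunP => E; apply: val_inj.
have /(congr1 (fun x : outcome G a => val (x E))) := e.
rewrite !relabel_outcomeE; apply: imset_inj.
exact/imset_inj/relabel_inj.
Qed.

Lemma outcome_adj_edge (w : outcome G a) (u x : G) (ux : [set u; x] \in edges G) i j :
  outcome_adj w (u, i) (x, j) =
  ([set (u, i); (x, j)] \in val (w (exist _ [set u; x] ux))).
Proof.
apply/existsP/idP => [[E uxE]|]; last by exists (exist _ [set u; x] ux).
by rewrite (_ : exist _ _ _ = E) //; apply: val_inj; rewrite -(matching_proj uxE).
Qed.

Lemma outcome_adj_relabel p w (u : G) i j : adj u v ->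
  outcome_adj (relabel_outcome p w) (u, j) (v, i) =
  outcome_adj w (u, j) (v, (p u)^-1%g i).
Proof.
move=> uv; have uvE : [set u; v] \in edges G by rewrite edge_adj.
have nuv : u != v by apply: contraTneq uv => ->; rewrite adj_irr.
rewrite !(outcome_adj_edge _ uvE) relabel_outcomeE /= other_endE //.
by rewrite mem_relabel_matching /relabel /= eqxx (negbTE nuv).
Qed.

Lemma outcome_adj_relabel_away p w (u x : G) i j : u != v -> x != v ->
  outcome_adj (relabel_outcome p w) (u, j) (x, i) = outcome_adj w (u, j) (x, i).
Proof.
move=> uv xv; apply: eq_existsb => E.
rewrite relabel_outcomeE mem_relabel_matching /relabel /=.
by rewrite (negbTE uv) (negbTE xv).
Qed.

End Relabel.

(** * Colours blocked by a neighbour *)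

Section Blocked.
Variables (G : sgraph) (a : nat) (w : outcome G a).

Definition blocked (S : {set 'I_a}) (u v : G) : {set 'I_a} :=
  [set i | [exists j in S, outcome_adj w (u, j) (v, i)]].

Lemma outcome_adj_total (u v : G) (j : 'I_a) : adj u v ->
  exists i, outcome_adj w (u, j) (v, i).
Proof.
move=> uv; have uvE : [set u; v] \in edges G by rewrite edge_adj.
have /andP[/forall_inP MP /forall_inP MV] := valP (w (exist _ [set u; v] uvE)).
have /forall_inP/(_ (u, j)) := MV u (set21 u v).
rewrite inE eqxx => /(_ isT) /cards1P[m em].
have : m \in [set m] by rewrite set11.
rewrite -em inE => /andP[mM um].
have /existsP[x /existsP[y /andP[/eqP xy /eqP e]]] := MP _ mM.
have nuv : u != v by apply: contraTneq uv => ->; rewrite adj_irr.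
have vxy : v \in [set x.1; y.1] by rewrite e set22.
move: um; rewrite xy !inE => /orP[]/eqP uxy; move: vxy; rewrite -uxy !inE /=.
  rewrite [v == u]eq_sym (negbTE nuv) /= => /eqP vy; exists y.2.
  rewrite (outcome_adj_edge _ uvE); rewrite xy -uxy in mM.
  by rewrite [(v, y.2)](_ : _ = y) // vy -surjective_pairing.
rewrite [v == u]eq_sym (negbTE nuv) orbF => /eqP vx; exists x.2.
rewrite (outcome_adj_edge _ uvE); rewrite xy -uxy finset.setUC in mM.
by rewrite [(v, x.2)](_ : _ = x) // vx -surjective_pairing.
Qed.

Lemma outcome_adj_fun (u v : G) (j i i' : 'I_a) :
  outcome_adj w (u, j) (v, i) -> outcome_adj w (u, j) (v, i') -> i = i'.
Proof.
move=> h h'; have uv : adj u v := outcome_adj_adj h.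
have inl (x : G) k : (x, k) \in layer a x by rewrite inE.
by have [] := layer_matching uv (inl u j) (inl v i) (inl v i') h h'.
Qed.

(** A perfect matching is a bijection between two lists.  Equality, rather than
    an upper bound, makes the mean in [unblocked_variance] exact. *)
Lemma card_blocked (S : {set 'I_a}) (u v : G) : adj u v -> #|blocked S u v| = #|S|.
Proof.
move=> uv; pose f j := xchoose (outcome_adj_total j uv).
have fP j : outcome_adj w (u, j) (v, f j) by apply: (xchooseP (outcome_adj_total j uv)).
rewrite -(card_imset (mem S) (_ : injective f)); last first.
  move=> j j' e; apply: (@outcome_adj_fun v u (f j)); rewrite outcome_adj_sym //.
  by rewrite e.
apply: eq_card => i; rewrite inE; apply/exists_inP/imsetP => [[j jS ji]|[j jS ->]].
  by exists j => //; apply: outcome_adj_fun ji (fP j).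
by exists j.
Qed.

End Blocked.

(** * The greedy colouring *)

Section Greedy.
Variables (G : sgraph) (a b : nat) (r : G -> nat).
Hypothesis ba : (b <= a)%N.

(** Always of size [b]: colours outside [A] are used only when [A] is too small.
    Thus every vertex blocks exactly [b] colours of each later neighbour, also
    in outcomes where the greedy procedure has already failed. *)
Definition select (A : {set 'I_a}) : {set 'I_a} :=
  [set i in take b (enum A ++ enum (~: A))].

Lemma card_select A : #|select A| = b.
Proof.
rewrite cardsE (card_uniqP _).
  rewrite size_takel // size_cat -!cardE cardsC card_ord //.
rewrite take_uniq // cat_uniq !enum_uniq andbT /=.
by apply/hasPn => i; rewrite !mem_enum inE.
Qed.

Lemma select_sub (A : {set 'I_a}) : (b <= #|A|)%N -> {subset select A <= A}.
Proof.
rewrite leq_eqVlt => bA i; rewrite inE take_cat -cardE.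
case/orP: bA => [/eqP ->|->]; last by move/mem_take; rewrite mem_enum.
by rewrite ltnn subnn take0 cats0 mem_enum.
Qed.

Definition back (v : G) : {set G} := [set u | adj u v & (r u < r v)%N].

Definition avail (w : outcome G a) (c : G -> {set 'I_a}) (v : G) : {set 'I_a} :=
  [set i | [forall u in back v, i \notin blocked w (c u) u v]].

(** The state when all vertices of rank below [n] have been processed.  The
    initial sets also have size [b], so that sizes are uniform at every stage. *)
Fixpoint colour (w : outcome G a) (n : nat) : G -> {set 'I_a} :=
  if n is n'.+1 then
    fun v => if r v == n' then select (avail w (colour w n') v) else colour w n' v
  else fun=> select finset.setT.

Lemma card_colour w n v : #|colour w n v| = b.
Proof.
elim: n => [|n IHn] /=; first exact: card_select.
by case: ifP => // _; apply: card_select.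
Qed.

Lemma colour_stable w n v : (r v < n)%N -> colour w n v = colour w (r v).+1 v.
Proof.
elim: n => // n IHn; rewrite ltnS leq_eqVlt => /orP[/eqP -> //|rn].
by rewrite -IHn //= ltn_eqF.
Qed.

Lemma eq_avail w w' c c' v :
  (forall u, u \in back v -> c u = c' u) ->
  (forall u i j, u \in back v ->
     outcome_adj w (u, i) (v, j) = outcome_adj w' (u, i) (v, j)) ->
  avail w c v = avail w' c' v.
Proof.
move=> cc ww; apply/setP => i; rewrite !inE; apply: eq_forallb_in => u uv.
congr (~~ _); rewrite !inE cc //; apply: eq_existsb => j; by rewrite ww.
Qed.

(** Vertices ranked before [v] were coloured using only edges that miss [v]. *)
Lemma colour_relabel v (p : {ffun G -> 'S_a}) w n : (n <= r v)%N ->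
  colour (relabel_outcome v p w) n =1 colour w n.
Proof.
elim: n => // n IHn nv u /=.
case: eqP => [un|_]; last by rewrite IHn // ltnW.
congr select; apply: eq_avail => [x _|x i j]; first by rewrite IHn // ltnW.
rewrite inE un => /andP[_ xn]; apply: outcome_adj_relabel_away.
  by apply: contraTneq xn => ->; rewrite -leqNgt ltnW.
by apply: contraTneq nv => <-; rewrite un -ltnNge ltnS.
Qed.

Definition options w v := avail w (colour w (r v)) v.

Lemma options_relabel v (p : {ffun G -> 'S_a}) w :
  options (relabel_outcome v p w) v =
  unblocked (back v) (fun u => blocked w (colour w (r v) u) u v) p.
Proof.
apply/setP => i; rewrite !inE; apply: eq_forallb_in => u.
rewrite inE => /andP[uv _]; rewrite [in RHS]inE.
rewrite -[i in RHS](permKV (p u)) mem_imset; last exact: perm_inj.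
congr (~~ _); rewrite !inE colour_relabel //; apply: eq_existsb => j.
by rewrite outcome_adj_relabel.
Qed.

Definition stuck (v : G) : {set outcome G a} := [set w | #|options w v| < b]%N.

(** Relabelling by a fixed [p] is a bijection, so the number of stuck outcomes is
    its average over [p]; for a fixed outcome the average over [p] is bounded by
    Chebyshev's inequality, the blocked sets being moved by independent uniform
    permutations. *)
Lemma stuck_bound (R : realType) (g : R) (v : G) : 0 <= g ->
  b%:R + a%:R * g <= a%:R * ((a - b)%N%:R / a%:R) ^+ #|back v| ->
  #|stuck v|%:R * (a%:R * g) ^+ 2 <= #|{: outcome G a}|%:R * a%:R.
Proof.
move=> g0 hg; pose K := {ffun G -> 'S_a}.
have K0 : 0 < #|{: K}|%:R :> R.
  by rewrite ltr0n; apply/card_gt0P; exists [ffun=> 1%g].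
rewrite -(ler_pM2l K0).
have -> : #|{: K}|%:R * (#|stuck v|%:R * (a%:R * g) ^+ 2) =
  \sum_(w : outcome G a) #|[set p : K | relabel_outcome v p w \in stuck v]|%:R
     * (a%:R * g) ^+ 2.
  rewrite -mulr_suml mulrA; congr (_ * _).
  rewrite -natr_sum -natrM; congr (_%:R).
  rewrite -sum_nat_const.
  rewrite (eq_bigr (fun p : K => \sum_w (relabel_outcome v p w \in stuck v))%N).
    rewrite exchange_big; apply: eq_bigr => w _.
    rewrite -sum1_card [RHS]big_mkcond; apply: eq_bigr => p _.
    by rewrite [in RHS]inE; case: ifP.
  move=> p _; rewrite -(card_preimset _ (@relabel_outcome_inj _ _ v p)).
  rewrite -sum1_card big_mkcond; apply: eq_bigr => w _.
  by rewrite inE; case: ifP.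
rewrite [leRHS](_ : _ = \sum_(w : outcome G a) #|{: K}|%:R * a%:R); last first.
  by rewrite sumr_const -[RHS]mulr_natl mulrCA.
apply: ler_sum => w _.
have cB u : u \in back v -> #|blocked w (colour w (r v) u) u v| = b.
  by rewrite inE => /andP[uv _]; rewrite card_blocked // card_colour.
apply: le_trans (unblocked_chebyshev cB g0 hg).
rewrite ler_wpM2r ?sqr_ge0 // ler_nat subset_leq_card //.
by apply/subsetP => p; rewrite !inE options_relabel.
Qed.

Hypothesis r_inj : injective r.

(** Of two adjacent vertices the later one avoided what the earlier one blocked. *)
Lemma colorable_not_stuck w : (forall v, w \notin stuck v) ->
  cover_colorable (random_cover w) b.
Proof.
move=> ok; pose c v := colour w (r v).+1 v.
have cP v : c v = select (options w v) by rewrite /c /= eqxx.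
pose S := [set x : G * 'I_a | x.2 \in c x.1].
have sep (u v : G) i j : (r u < r v)%N -> (u, i) \in S -> (v, j) \in S ->
    ~~ outcome_adj w (u, i) (v, j).
  rewrite !inE /= [c v]cP => uv ic jc; apply/negP => ij.
  have := ok v; rewrite inE -leqNgt => /select_sub/(_ _ jc).
  rewrite inE => /forall_inP/(_ u); rewrite !inE uv.
  rewrite (outcome_adj_adj ij) => /(_ isT)/exists_inP[]; exists i => //.
  by rewrite colour_stable.
apply/existsP; exists S; apply/andP; split.
  apply/forallP => v /=; rewrite -(card_colour w (r v).+1 v) -/(c v).
  rewrite -(card_imset (mem (c v)) (_ : injective (pair v))); last by move=> ? ? [].
  apply/eqP/eq_card => -[u i]; rewrite !inE /=.
  apply/andP/imsetP => [[/eqP -> ic]|[j jc [-> ->]]]; first by exists i.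
  by rewrite eqxx.
apply/forall_inP => -[u i] uiS; apply/forall_inP => -[v j] vjS.
have [uv|uv|/r_inj uv] := ltngtP (r u) (r v); first exact: sep.
  by rewrite /= outcome_adj_sym; apply: sep.
by subst; apply/negP => /outcome_adj_adj; rewrite adj_irr.
Qed.

End Greedy.

(** * The sample space *)

Section Probability.
Variables (G : sgraph) (a : nat).

(** Matching equal colours is a perfect matching for every edge. *)
Lemma outcome_nonempty : (0 < #|{: outcome G a}|)%N.
Proof.
pose M (E : edge G) : {set {set G * 'I_a}} :=
  [set [set (x, i) | x in val E] | i : 'I_a].
suff h E : perfect_matching (val E) (M E).
  by apply/card_gt0P; exists [ffun E : edge G => exist _ (M E) (h E)].
rewrite {}/M.
case: E => E /= EG; move: (EG); rewrite inE => /existsP[u /existsP[v /andP[uv /eqP eE]]].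
have im i : [set (x, i) | x in E] = [set (u, i); (v, i)] :> {set G * 'I_a}.
  by rewrite eE imsetU !imset_set1.
apply/andP; split.
  apply/forall_inP => _ /imsetP[i _ ->]; apply/existsP; exists (u, i).
  by apply/existsP; exists (v, i); rewrite im eqxx eE eqxx.
apply/forall_inP => x xE; apply/forall_inP => -[y i]; rewrite inE /= => /eqP ->.
apply/cards1P; exists [set (z, i) | z in E]; apply/setP => m; rewrite !inE.
apply/andP/eqP => [[/imsetP[j _ ->] /imsetP[z _ [_ ->]]] //|->].
by split; [apply: imset_f | apply: imset_f].
Qed.

Variable R : realType.

Lemma outcome_probE (P : pred (outcome G a)) :
  outcome_prob R P = #|P|%:R / #|{: outcome G a}|%:R.
Proof.
rewrite /outcome_prob (eq_bigr (fun=> #|{: outcome G a}|%:R^-1)).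
  by rewrite sumr_const -[LHS]mulr_natl.
move=> w _; rewrite /outcome_mass card_dep_ffun foldrE big_image /= natr_prod.
by rewrite prodfV.
Qed.

Lemma outcome_prob_le1 (P : pred (outcome G a)) : outcome_prob R P <= 1.
Proof.
rewrite outcome_probE ler_pdivrMr ?ltr0n ?outcome_nonempty // mul1r ler_nat.
exact: max_card.
Qed.

End Probability.

(** * The size of the lists *)

Lemma expR_ge_sqr (R : realType) (z : R) : 0 <= z -> z ^+ 2 / 4 <= expR z.
Proof.
move=> z0; have -> : z = z / 2 * 2%:R by field.
rewrite expRM_natr; have := expR_ge1Dx (z / 2) => h.
apply: (@le_trans _ _ ((1 + z / 2) ^+ 2)); first by nra.
by apply: lerXn2r; rewrite ?nnegrE ?expR_ge0 //; lra.
Qed.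

(** From [1 + t <= expR t] at [t = (y - 1)^-1], since [1 - y^-1 = (1 + t)^-1]. *)
Lemma pow_ge_expR (R : realType) (y : R) (d : nat) : 1 < y ->
  expR (- (d%:R / (y - 1))) <= (1 - y^-1) ^+ d.
Proof.
move=> y1; have y0 : 0 < y by lra.
have y10 : 0 < y - 1 by lra.
rewrite expRN [_ / _]mulrC expRM_natr -exprVn; apply: lerXn2r.
- by rewrite nnegrE invr_ge0 expR_ge0.
- by rewrite nnegrE subr_ge0 invf_le1 // ltW.
have -> : 1 - y^-1 = (1 + (y - 1)^-1)^-1.
  by field; rewrite subrK !gt_eqF.
by rewrite lef_pV2 ?posrE ?expR_gt0 ?expR_ge1Dx // addr_gt0 // invr_gt0.
Qed.

(** With [y = ln d] and [a0] the integer part of [(1 + eps) d / y], the rounding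
    costs at most [eps / 2] for large [d], and [pow_ge_expR] gives at least
    [expR (- y / (1 + eps / 2)) = expR (c y) / d] on the right, where
    [c = eps / (2 + eps)].  As [1 / a0 < y / d], it remains that [y <= expR (c y)],
    true for large [y]. *)
Lemma list_size_exists (R : realType) (eps : R) : 0 < eps ->
  exists d0 : nat, forall d : nat, (d0 <= d)%N ->
  exists a0 : nat, [/\ (0 < a0)%N,
    a0%:R <= (1 + eps) * d%:R / ln d%:R
  & a0%:R^-1 < (1 - a0%:R^-1 : R) ^+ d].
Proof.
move=> e0.
pose c : R := eps / (2 + eps).
(* 4 / c ^+ 2 <= ln d gives y <= expR (c * y), and 16 / eps <= ln d makes
   eps / 2 * (d / ln d) at least 2, one unit for rounding and one for a0 - 1. *)
pose Y : R := 1 + 4 / c ^+ 2 + 16 / eps.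
have c0 : 0 < c by rewrite divr_gt0 //; lra.
have c2 : 0 < 4 / c ^+ 2 by rewrite divr_gt0 // exprn_gt0.
have e16 : 0 < 16 / eps by rewrite divr_gt0.
exists (Num.truncn (expR Y)).+1 => d dd0.
have dY : expR Y <= d%:R.
  by apply: ltW; apply: lt_le_trans (truncnS_gt _) _; rewrite ler_nat.
have d0 : 0 < d%:R :> R := lt_le_trans (expR_gt0 Y) dY.
set y := ln d%:R.
have dy : d%:R = expR y by rewrite lnK.
have yY : Y <= y by rewrite -ler_expR -dy.
have y0 : 0 < y by rewrite /Y in yY; lra.
have dy4 : y ^+ 2 / 4 <= d%:R by rewrite dy expR_ge_sqr // ltW.
have ycy : y <= expR (c * y).
  have := @expR_ge_sqr _ (c * y) (mulr_ge0 (ltW c0) (ltW y0)).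
  apply: le_trans.
  have : 4 / c ^+ 2 <= y by rewrite /Y in yY; lra.
  rewrite ler_pdivrMr ?exprn_gt0 // => h.
  by rewrite exprMn; nra.
set t := (1 + eps) * d%:R / y.
set r := d%:R / y.
have rE : t = (1 + eps) * r by rewrite /t /r mulrA.
have r4 : 4 / eps <= r.
  have h : 16 / eps <= y by rewrite /Y in yY; lra.
  rewrite /r ler_pdivlMr //; apply: le_trans dy4.
  have -> : 4 / eps = 16 / eps / 4 by field; rewrite gt_eqF.
  by nra.
have er : 4 <= eps * r by move: r4; rewrite ler_pdivrMr // mulrC.
have r0 : 0 < r by rewrite divr_gt0.
exists (Num.truncn t).
have t0 : 0 <= t by rewrite rE mulr_ge0 //; lra.
have /andP[at1 at2] := truncn_itv t0.
set a := (Num.truncn t)%:R : R in at1 *.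
have {}at2 : t < a + 1 by rewrite -natr1 in at2.
have a1 : (1 + eps / 2) * r <= a - 1 by lra.
have a11 : 1 < a by nra.
split=> //.
  by rewrite -(ltr0n R) -/a; lra.
apply: lt_le_trans (pow_ge_expR d a11).
have h1 : d%:R / (a - 1) <= y / (1 + eps / 2).
  rewrite ler_pdivrMr; last by lra.
  rewrite mulrAC ler_pdivlMr; last by lra.
  have -> : d%:R = r * y by rewrite /r divfK // gt_eqF.
  by nra.
apply: (@lt_le_trans _ _ (expR (- (y / (1 + eps / 2))))); last first.
  by rewrite ler_expR lerN2.
have -> : - (y / (1 + eps / 2)) = c * y - y.
  by rewrite /c; field; rewrite !gt_eqF // ?addr_gt0 // divr_gt0.
rewrite expRD expRN -dy.
apply: (@lt_le_trans _ _ (y / d%:R)); last by rewrite ler_wpM2r // invr_ge0 ltW.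
rewrite -invf_div -/r ltf_pV2 ?posrE //; last by lra.
by nra.
Qed.

(** * Union bound over the vertices *)

Lemma degenerate_rank (G : sgraph) (d : nat) : degenerate G d ->
  exists2 r : G -> nat, injective r & forall v, (#|back r v| <= d)%N.
Proof.
case/existsP => s /andP[us /forallP sd]; exists (index^~ s) => //.
have sG : s =i predT.
  by apply/subset_cardP; rewrite ?subset_predT // (card_uniqP us) size_tuple.
have ins v : v \in tval s by rewrite [v \in _]sG.
by move=> u v e; rewrite -[u](nth_index u (ins u)) e nth_index.
Qed.

(** Each vertex is stuck with probability at most [1 / (a * g ^+ 2)], where
    [a = m * a0] tends to infinity with [m] while [g] and the graph stay fixed. *)
Lemma colorable_prob (R : realType) (G : sgraph) (d a0 m : nat) (g : R) :
  degenerate G d -> (0 < a0)%N -> (0 < m)%N -> 0 < g ->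
  a0%:R^-1 + g <= (1 - a0%:R^-1) ^+ d ->
  1 - #|G|%:R / ((m * a0)%N%:R * g ^+ 2) <=
    outcome_prob R (fun w : outcome G (m * a0) => cover_colorable (random_cover w) m).
Proof.
move=> Gd a0_gt0 m_gt0 g_gt0 hg; have [r r_inj rd] := degenerate_rank Gd.
set a := (m * a0)%N; set P := fun _ => _.
have ma : (m <= a)%N by rewrite leq_pmulr.
have a0R : 0 < a0%:R :> R by rewrite ltr0n.
have mR : 0 < m%:R :> R by rewrite ltr0n.
have aE : a%:R = m%:R * a0%:R :> R by rewrite natrM.
have aR : 0 < a%:R :> R by rewrite aE mulr_gt0.
have xE : (a - m)%N%:R / a%:R = 1 - a0%:R^-1 :> R.
  by rewrite natrB // aE; field; rewrite !gt_eqF.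
have x01 : 0 <= (1 - a0%:R^-1 : R) <= 1.
  by rewrite -xE divr_ge0 //= ler_pdivrMr // mul1r ler_nat leq_subr.
have O0 : 0 < #|{: outcome G a}|%:R :> R by rewrite ltr0n outcome_nonempty.
have ag2 : 0 < a%:R * g ^+ 2 by rewrite mulr_gt0 // exprn_gt0.
have stuck_le v : #|stuck a m r v|%:R <= #|{: outcome G a}|%:R / (a%:R * g ^+ 2) :> R.
  have /(stuck_bound ma (ltW g_gt0)) :
      m%:R + a%:R * g <= a%:R * ((a - m)%N%:R / a%:R) ^+ #|back r v|.
    rewrite xE; have -> : m%:R = a%:R * a0%:R^-1 :> R by rewrite aE mulfK ?gt_eqF.
    rewrite -mulrDr ler_wpM2l ?(ltW aR) //; apply: le_trans hg _.
    by apply: ler_wiXn2l (rd v); case/andP: x01.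
  rewrite exprMn expr2 -!mulrA mulrCA [leRHS]mulrC ler_pM2l // => h.
  by rewrite ler_pdivlMr.
have cover : (#|{: outcome G a}| <= #|P| + \sum_v #|stuck a m r v|)%N.
  apply: (@leq_trans (#|P| + #|\bigcup_v stuck a m r v|)); last first.
    rewrite leq_add2l; elim/big_rec2: _ => [|v n S _ IH]; first by rewrite cards0.
    by apply: leq_trans (leq_card_setU _ _) _; rewrite leq_add2l.
  rewrite -(cardC P) leq_add2l; apply/subset_leq_card/subsetP => w.
  rewrite !inE; apply: contraR => /bigcupP nw.
  apply: (colorable_not_stuck ma r_inj) => v; apply/negP => wv.
  by apply: nw; exists v.
rewrite outcome_probE ler_pdivlMr // mulrBl mul1r lerBlDr.
move: cover; rewrite -(ler_nat R) natrD natr_sum => /le_trans; apply.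
rewrite lerD2l; apply: le_trans (ler_sum _ (fun v _ => stuck_le v)) _.
by rewrite sumr_const -[leLHS]mulr_natl mulrCA mulrC.
Qed.

Theorem theorem1p10 (R : realType) (eps : R) (heps : 0 < eps) :
  exists d0 : nat, forall (G : sgraph) (k : R),
    (d0 <= degeneracy G)%N ->
    (1 + eps) * (degeneracy G)%:R / ln (degeneracy G)%:R <= k ->
    1 - eps <= pstar G k.
Proof.
have [d0 fold] := list_size_exists heps; exists d0 => G k /fold[a0 [a0_gt0 a0d a0g]] hk.
have Gd : degenerate G (degeneracy G) by rewrite /degeneracy; case: ex_minnP.
set d := degeneracy G in a0d a0g hk Gd.
pose g := (1 - a0%:R^-1) ^+ d - a0%:R^-1 : R.
have g_gt0 : 0 < g by rewrite subr_gt0.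
have a0R : 0 < a0%:R :> R by rewrite ltr0n.
have A0 : 0 < a0%:R * g ^+ 2 * eps by rewrite !mulr_gt0 // exprn_gt0.
(* Large enough for the failure probability #|G| / (m * a0 * g ^+ 2) <= eps. *)
pose m := (Num.truncn (#|G|%:R / (a0%:R * g ^+ 2 * eps))).+1.
have mP : #|G|%:R / (a0%:R * g ^+ 2 * eps) <= m%:R by rewrite ltW ?truncnS_gt.
have := @colorable_prob R G d a0 m g Gd a0_gt0 isT g_gt0.
rewrite addrC subrK lexx => /(_ isT).
set p := outcome_prob R _ => p_ge; apply: (@le_trans _ _ p).
  apply: le_trans p_ge; rewrite lerD2l lerN2 natrM.
  rewrite ler_pdivrMr ?mulr_gt0 ?exprn_gt0 //.
  by move: mP; rewrite ler_pdivrMr //; lra.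
apply: ub_le_sup.
  by exists 1 => _ [a [b [_ _ <-]]]; exact: outcome_prob_le1.
exists (m * a0)%N, m; split=> //; apply: le_trans hk; apply: le_trans a0d.
by rewrite natrM mulrAC divff ?mul1r // pnatr_eq0.
Qed.
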